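(* Let $a,c,d\in\mathbb{H}_s$ and let $A=\begin{pmatrix} a&0\\ c&d\end{pmatrix}\in \mathbb{H}_s^{2\times 2}$. Then the following hold. (1) If $S_L(a-d,c)\neq\emptyset$, then $a\in\sigma_l(A)$ and $(1,x)^T\in V_l(a)$ for all $x\in S_L(a-d,c)$. (2) We have $0\in S_Q(c,d-a,0)$ (so $S_Q(c,d-a,0)\neq\emptyset$), and for every $x\in S_Q(c,d-a,0)$, setting $\lambda=cx+d$, we have $\lambda\in\sigma_l(A)$ and $(x,1)^T\in V_l(\lambda)$. (3) In particular, $d\in\sigma_l(A)$, and $(x,1)^T\in V_l(d)$ for all $x\in S_L(c,0)\cap S_L(d-a,0)$. Moreover, $a\in\sigma_l(A)$ if and only if $S_L(a-d,c)\cup S_L(c,a-d)\neq\emptyset$. In this case, $a\in\sigma_l(A)$ with eigenvectors $v=(x,1)^T$ for all $x\in S_L(c,a-d)$ (provided $S_L(c,a-d)\neq\emptyset$) and $v=(1,x)^T$ for all $x\in S_L(a-d,c)$ (provided $S_L(a-d,c)\neq\emptyset$).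
   Context: $\mathbb{H}_s$ denotes the split quaternion algebra: the associative real algebra with basis $1,\mathbf{i},\mathbf{j},\mathbf{k}$, unit $1$, and multiplication $\mathbf{i}^2=-1$, $\mathbf{j}^2=\mathbf{k}^2=1$, $\mathbf{i}\mathbf{j}=-\mathbf{j}\mathbf{i}=\mathbf{k}$, $\mathbf{j}\mathbf{k}=-\mathbf{k}\mathbf{j}=-\mathbf{i}$, $\mathbf{k}\mathbf{i}=-\mathbf{i}\mathbf{k}=\mathbf{j}$. For $x=x_0+x_1\mathbf{i}+x_2\mathbf{j}+x_3\mathbf{k}$ with $x_i\in\mathbb{R}$, put $\bar x=x_0-x_1\mathbf{i}-x_2\mathbf{j}-x_3\mathbf{k}$ and $I_x=\bar x x=x\bar x=x_0^2+x_1^2-x_2^2-x_3^2$. Let $Z(\mathbb{H}_s)=\{x\in\mathbb{H}_s: I_x=0\}$; this is the set of noninvertible elements (it contains $0$). Left eigenvalues: for $A\in\mathbb{H}_s^{n\times n}$, an element $\lambda\in\mathbb{H}_s$ is a left eigenvalue of $A$ if there is $x\in\mathbb{H}_s^n$ with $x\notin Z(\mathbb{H}_s)^n$ (i.e. at least one component of $x$ is invertible) such that $Ax=\lambda x$, where $\lambda x$ is componentwise left multiplication. The set of left eigenvalues of $A$ is the left spectrum $\sigma_l(A)$. For $\lambda\in\sigma_l(A)$, $V_l(\lambda)=\{x\in\mathbb{H}_s^n: Ax=\lambda x\}$. An eigenvector for $\lambda$ is an $x\in V_l(\lambda)$ with $x\notin Z(\mathbb{H}_s)^n$. Solution sets: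 for $p,q,r\in\mathbb{H}_s$, $S_L(p,q)=\{x\in\mathbb{H}_s: px=q\}$ and $S_Q(p,q,r)=\{x\in\mathbb{H}_s: px^2+qx+r=0\}$ (with $p=0$ allowed). *)

(* Defs.v *)
From HB Require Import structures.
From mathcomp Require Import all_boot all_order all_algebra.
From mathcomp Require Import boolp classical_sets reals.
From mathcomp Require Import ring.

Set Implicit Arguments.
Unset Strict Implicit.
Unset Printing Implicit Defensive.

Import Order.TTheory GRing.Theory Num.Theory.
Local Open Scope ring_scope.
Local Open Scope classical_set_scope.

(* [SQuat x0 x1 x2 x3] is x0 + x1 i + x2 j + x3 k. *)
Record squat (R : realType) := SQuat { sq0 : R; sq1 : R; sq2 : R; sq3 : R }.

Section SplitQuaternionAlgebra.
Variable R : realType.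
Local Notation H := (squat R).
Implicit Types x y z : H.

Definition squat_tuple x := (sq0 x, sq1 x, sq2 x, sq3 x).
Definition tuple_squat (t : R * R * R * R) :=
  let: (x0, x1, x2, x3) := t in SQuat x0 x1 x2 x3.
Lemma squat_tupleK : cancel squat_tuple tuple_squat. Proof. by case. Qed.

HB.instance Definition _ := Choice.copy H (can_type squat_tupleK).

Definition sq_add x y :=
  SQuat (sq0 x + sq0 y) (sq1 x + sq1 y) (sq2 x + sq2 y) (sq3 x + sq3 y).
Definition sq_opp x := SQuat (- sq0 x) (- sq1 x) (- sq2 x) (- sq3 x).
Definition sq_zero : H := SQuat 0 0 0 0.

Lemma sq_addA : associative sq_add.
Proof. by move=> [????] [????] [????]; congr SQuat; exact: addrA. Qed.
Lemma sq_addC : commutative sq_add.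
Proof. by move=> [????] [????]; congr SQuat; exact: addrC. Qed.
Lemma sq_add0 : left_id sq_zero sq_add.
Proof. by move=> [????]; congr SQuat; exact: add0r. Qed.
Lemma sq_addN : left_inverse sq_zero sq_opp sq_add.
Proof. by move=> [????]; congr SQuat; exact: addNr. Qed.

HB.instance Definition _ :=
  GRing.isZmodule.Build H sq_addA sq_addC sq_add0 sq_addN.

(* Bilinear extension of i^2 = -1, j^2 = k^2 = 1, ij = -ji = k,
   jk = -kj = -i, ki = -ik = j; see [squat_table]. *)
Definition sq_mul x y := SQuat
  (sq0 x * sq0 y - sq1 x * sq1 y + sq2 x * sq2 y + sq3 x * sq3 y)
  (sq0 x * sq1 y + sq1 x * sq0 y - sq2 x * sq3 y + sq3 x * sq2 y)
  (sq0 x * sq2 y + sq2 x * sq0 y + sq3 x * sq1 y - sq1 x * sq3 y)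
  (sq0 x * sq3 y + sq3 x * sq0 y + sq1 x * sq2 y - sq2 x * sq1 y).
Definition sq_one : H := SQuat 1 0 0 0.

Lemma sq_mulA : associative sq_mul.
Proof. by move=> [????] [????] [????]; congr SQuat => /=; ring. Qed.
Lemma sq_mul1l : left_id sq_one sq_mul.
Proof. by move=> [????]; congr SQuat => /=; ring. Qed.
Lemma sq_mul1r : right_id sq_one sq_mul.
Proof. by move=> [????]; congr SQuat => /=; ring. Qed.
Lemma sq_mulDl : left_distributive sq_mul +%R.
Proof. by move=> [????] [????] [????]; congr SQuat => /=; ring. Qed.
Lemma sq_mulDr : right_distributive sq_mul +%R.
Proof. by move=> [????] [????] [????]; congr SQuat => /=; ring. Qed.
Lemma sq_one_neq0 : sq_one != 0.
Proof. by apply/eqP => -[/eqP]; rewrite oner_eq0. Qed.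

HB.instance Definition _ := GRing.Zmodule_isNzRing.Build H
  sq_mulA sq_mul1l sq_mul1r sq_mulDl sq_mulDr sq_one_neq0.

Definition sq_scale (r : R) x :=
  SQuat (r * sq0 x) (r * sq1 x) (r * sq2 x) (r * sq3 x).

Lemma sq_scaleA r s x : sq_scale r (sq_scale s x) = sq_scale (r * s) x.
Proof. by congr SQuat; exact: mulrA. Qed.
Lemma sq_scale1 : left_id 1 sq_scale.
Proof. by move=> [????]; congr SQuat; exact: mul1r. Qed.
Lemma sq_scaleDr : right_distributive sq_scale +%R.
Proof. by move=> r [????] [????]; congr SQuat; exact: mulrDr. Qed.
Lemma sq_scaleDl x : {morph sq_scale^~ x : r s / r + s}.
Proof. by move=> r s; congr SQuat; exact: mulrDl. Qed.

HB.instance Definition _ := GRing.Zmodule_isLmodule.Build R H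
  sq_scaleA sq_scale1 sq_scaleDr sq_scaleDl.

Lemma sq_scaleAl (r : R) x y : r *: (x * y) = (r *: x) * y.
Proof. by congr SQuat => /=; ring. Qed.
Lemma sq_scaleAr (r : R) x y : r *: (x * y) = x * (r *: y).
Proof. by congr SQuat => /=; ring. Qed.

HB.instance Definition _ := GRing.Lmodule_isLalgebra.Build R H sq_scaleAl.
HB.instance Definition _ := GRing.Lalgebra_isAlgebra.Build R H sq_scaleAr.

Definition sq_i : H := SQuat 0 1 0 0.
Definition sq_j : H := SQuat 0 0 1 0.
Definition sq_k : H := SQuat 0 0 0 1.

Lemma squat_basis x :
  x = (sq0 x)%:A + sq1 x *: sq_i + sq2 x *: sq_j + sq3 x *: sq_k.
Proof. by case: x => ????; congr SQuat => /=; ring. Qed.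

Lemma squat_table :
  [/\ sq_i ^+ 2 = -1, sq_j ^+ 2 = 1 & sq_k ^+ 2 = 1] /\
  [/\ sq_i * sq_j = sq_k, sq_j * sq_k = - sq_i & sq_k * sq_i = sq_j] /\
  [/\ sq_j * sq_i = - sq_k, sq_k * sq_j = sq_i & sq_i * sq_k = - sq_j].
Proof. by do !split; congr SQuat => /=; ring. Qed.

Definition sq_conj x := SQuat (sq0 x) (- sq1 x) (- sq2 x) (- sq3 x).

(* I_x *)
Definition sq_norm x : R :=
  sq0 x ^+ 2 + sq1 x ^+ 2 - sq2 x ^+ 2 - sq3 x ^+ 2.

Lemma sq_conjMl x : sq_conj x * x = (sq_norm x)%:A.
Proof. by congr SQuat => /=; rewrite /sq_norm; ring. Qed.
Lemma sq_conjMr x : x * sq_conj x = (sq_norm x)%:A.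
Proof. by congr SQuat => /=; rewrite /sq_norm; ring. Qed.

Lemma sq_normM x y : sq_norm (x * y) = sq_norm x * sq_norm y.
Proof. by rewrite /sq_norm /=; ring. Qed.

Definition sq_unit : pred H := fun x => sq_norm x != 0.
Definition sq_inv x : H :=
  if sq_norm x == 0 then x else (sq_norm x)^-1 *: sq_conj x.

Lemma sq_mulVr : {in sq_unit, left_inverse 1 sq_inv *%R}.
Proof.
move=> x; rewrite unfold_in /sq_unit /sq_inv => Nx.
by rewrite (negPf Nx) -scalerAl sq_conjMl scalerA mulVf // scale1r.
Qed.
Lemma sq_divrr : {in sq_unit, right_inverse 1 sq_inv *%R}.
Proof.
move=> x; rewrite unfold_in /sq_unit /sq_inv => Nx.
by rewrite (negPf Nx) -scalerAr sq_conjMr scalerA mulVf // scale1r.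
Qed.
Lemma sq_unitP x y : y * x = 1 /\ x * y = 1 -> sq_unit x.
Proof.
case=> yx1 _; rewrite /sq_unit; apply/negP => /eqP Nx0.
have := sq_normM y x; rewrite yx1 Nx0 mulr0 /sq_norm /= !expr0n /= !subr0.
by rewrite addr0 expr1n => /eqP; rewrite oner_eq0.
Qed.
Lemma sq_inv_out : {in [predC sq_unit], sq_inv =1 id}.
Proof. by move=> x; rewrite inE => /negPn Nx; rewrite /sq_inv Nx. Qed.

HB.instance Definition _ := GRing.NzRing_hasMulInverse.Build H
  sq_mulVr sq_divrr sq_unitP sq_inv_out.

Definition Zs : set H := [set x | sq_norm x = 0].

Lemma Zs_nonunit x : Zs x <-> x \isn't a GRing.unit.
Proof.
change (sq_norm x = 0 <-> ~~ (sq_norm x != 0)).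
by rewrite negbK; split=> /eqP.
Qed.

End SplitQuaternionAlgebra.

Section LeftEigenvalues.
Variables (R : realType) (n : nat).
Local Notation H := (squat R).
Implicit Types (A : 'M[H]_n) (l : H).

(* Z(H_s)^n *)
Definition Zsn : set 'cV[H]_n := [set v | forall i, Zs (v i 0)].

(* [l *: v] is componentwise left multiplication by [l]. *)
Definition V_l A l : set 'cV[H]_n := [set v | A *m v = l *: v].

Definition left_eigenvector A l (v : 'cV[H]_n) := V_l A l v /\ ~ Zsn v.

Definition sigma_l A : set H := [set l | exists v, left_eigenvector A l v].

End LeftEigenvalues.

Section SolutionSets.
Variable R : realType.
Local Notation H := (squat R).

Definition S_L (p q : H) : set H := [set x | p * x = q].
Definition S_Q (p q r : H) : set H := [set x | p * x ^+ 2 + q * x + r = 0].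

End SolutionSets.

Definition mx22 (T : Type) (a b c d : T) : 'M[T]_2 :=
  \matrix_(i, j) if i == 0 then (if j == 0 then a else b)
                 else (if j == 0 then c else d).

Definition cv2 (T : Type) (x y : T) : 'cV[T]_2 :=
  \col_i if i == 0 then x else y.

(* Main.v *)
(* An eigenvector for the eigenvalue a has an invertible entry; multiplying it
   on the right by the inverse of that entry, which commutes with A and with the
   left action of a, normalizes it to (1, x) or (x, 1). *)
Require Import Defs.
From mathcomp Require Import all_boot all_order all_algebra.
From mathcomp Require Import boolp classical_sets reals.

Set Implicit Arguments.
Unset Strict Implicit.
Unset Printing Implicit Defensive.

Import Order.TTheory GRing.Theory Num.Theory.
Local Open Scope ring_scope.
Local Open Scope classical_set_scope.

Lemma V_l_lower (R : realType) (a c d l x y : squat R) :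
  V_l (mx22 a 0 c d) l (cv2 x y) <-> a * x = l * x /\ c * x + d * y = l * y.
Proof.
split=> [/matrixP e|[e0 e1]].
  have := e 0 0; have := e 1 0.
  by rewrite !mxE !big_ord_recl !big_ord0 !mxE /= mul0r !addr0.
apply/matrixP=> i j; rewrite !mxE !big_ord_recl !big_ord0 !mxE /=.
by case: ifP => _; rewrite ?mul0r !addr0.
Qed.

Lemma cv2E (T : Type) (v : 'cV[T]_2) : v = cv2 (v 0 0) (v 1 0).
Proof.
apply/colP=> i; rewrite !mxE.
by case: i => [[|[|//]] ltn2] /=; congr (v _ _); apply: val_inj.
Qed.

(** Expresses the eigenvector condition through ring units, so that an invertible entry can be
    divided by. *)
Lemma Zsn_cv2 (R : realType) (x y : squat R) :
  ~ Zsn (cv2 x y) <-> x \is a GRing.unit \/ y \is a GRing.unit.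
Proof.
split=> [nZ|[] Uz Z].
- have [Ux|nUx] := boolP (x \is a GRing.unit); [by left | right].
  have [//|nUy] := boolP (y \is a GRing.unit).
  case: nZ => i; rewrite mxE.
  by case: ifP => _; apply/Zs_nonunit.
- by have := Z 0; rewrite mxE /= => /Zs_nonunit; rewrite Uz.
- by have := Z 1; rewrite mxE /= => /Zs_nonunit; rewrite Uz.
Qed.

(** The choice of eigenvalue makes the second row an identity; the first row,
    [a * x = (c * x + d) * x], is the quadratic equation rearranged. *)
Lemma left_eigenvector_S_Q (R : realType) (a c d x : squat R) :
  S_Q c (d - a) 0 x -> left_eigenvector (mx22 a 0 c d) (c * x + d) (cv2 x 1).
Proof.
rewrite /S_Q /= addr0 expr2 mulrBl addrA => /subr0_eq e.
split; last by apply/Zsn_cv2; right; exact: unitr1.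
by apply/V_l_lower; rewrite !mulr1 mulrDl -mulrA e.
Qed.

(** Here the first row is [a = a], and the second, [c + d * x = a * x], is the linear equation. *)
Lemma left_eigenvector_S_L (R : realType) (a c d x : squat R) :
  S_L (a - d) c x -> left_eigenvector (mx22 a 0 c d) a (cv2 1 x).
Proof.
rewrite /S_L /= => e; split; last by apply/Zsn_cv2; left; exact: unitr1.
by apply/V_l_lower; rewrite !mulr1 -e mulrBl subrK.
Qed.

(** Right multiplication of [c * x = a - d] by [x] gives the quadratic equation. *)
Lemma S_L_sub_S_Q (R : realType) (a c d x : squat R) :
  S_L c (a - d) x -> S_Q c (d - a) 0 x.
Proof.
rewrite /S_L /S_Q /= => e.
by rewrite addr0 expr2 mulrA e -mulrDl addrA subrK subrr mul0r.
Qed.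

Lemma sigma_l_lowerP (R : realType) (a c d : squat R) :
  sigma_l (mx22 a 0 c d) a <-> (S_L (a - d) c `|` S_L c (a - d)) !=set0.
Proof.
split=> [[v]|[x [/left_eigenvector_S_L xP|xP]]].
- rewrite (cv2E v) => -[/V_l_lower[_ /eqP]] /[swap] /Zsn_cv2.
  (* At eigenvalue [a] the first row is a tautology; the second becomes
     [(a - d) * v 1 0 = c * v 0 0]. *)
  rewrite addrC eq_sym -subr_eq0 opprD addrA -mulrBl => U /eqP /subr0_eq e.
  case: U => U; [exists (v 1 0 / v 0 0); left | exists (v 0 0 / v 1 0); right].
    by rewrite /S_L /= mulrA e mulrK.
  by rewrite /S_L /= mulrA -e mulrK.
- by exists (cv2 1 x).
(* Since [c * x = a - d], the eigenvalue [c * x + d] equals [a]. *)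
- exists (cv2 x 1); have := left_eigenvector_S_Q (S_L_sub_S_Q xP).
  by rewrite xP subrK.
Qed.

Theorem theorem3p1 (R : realType) (a c d : squat R) :
  let A : 'M[squat R]_2 := mx22 a 0 c d in
  (S_L (a - d) c !=set0 ->
     sigma_l A a /\ (forall x, S_L (a - d) c x -> V_l A a (cv2 1 x)))
  /\
  (S_Q c (d - a) 0 0 /\ S_Q c (d - a) 0 !=set0 /\
   (forall x, S_Q c (d - a) 0 x ->
      let lambda := c * x + d in
      sigma_l A lambda /\ V_l A lambda (cv2 x 1)))
  /\
  (sigma_l A d /\
   (forall x, (S_L c 0 `&` S_L (d - a) 0) x -> V_l A d (cv2 x 1)) /\
   (sigma_l A a <-> (S_L (a - d) c `|` S_L c (a - d)) !=set0) /\
   ((S_L (a - d) c `|` S_L c (a - d)) !=set0 ->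
      sigma_l A a /\
      (forall x, S_L c (a - d) x -> left_eigenvector A a (cv2 x 1)) /\
      (forall x, S_L (a - d) c x -> left_eigenvector A a (cv2 1 x)))).
Proof.
move=> A.
have Q0 : S_Q c (d - a) 0 0 by rewrite /S_Q /= expr0n !mulr0 !addr0.
have LQ x : S_L c (a - d) x -> left_eigenvector A a (cv2 x 1).
  by move=> xP; have := left_eigenvector_S_Q (S_L_sub_S_Q xP); rewrite xP subrK.
split; [|split].
- move=> [x xP]; split=> [|y /left_eigenvector_S_L[] //].
  by exists (cv2 1 x); exact: left_eigenvector_S_L.
- split=> //; split; first by exists 0.
  move=> x /left_eigenvector_S_Q xP; split; last by case: xP.
  by exists (cv2 x 1).
- split; [|split; [|split]].
  (* The root [0] of the quadratic gives eigenvalue [c * 0 + d = d]. *)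
  + by exists (cv2 0 1); have := left_eigenvector_S_Q Q0; rewrite mulr0 add0r.
  + move=> x [cx dax]; apply/V_l_lower; rewrite cx add0r; split=> //.
    (* The remaining first row, [a * x = d * x], is [(d - a) * x = 0]. *)
    by apply/esym/subr0_eq; rewrite -mulrBl.
  + exact: sigma_l_lowerP.
  + move=> /sigma_l_lowerP sa; split=> //; split=> [|x] //.
    exact: left_eigenvector_S_L.
Qed.
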